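(* Let $\kappa$ be a regular infinite cardinal and $\mu$ a singular cardinal with $\mathrm{cf}(\mu)=\kappa$. Then $\mu^{<\mu}\le\mathrm{non}(\mathcal M_\kappa({}^{\mu}2,\mu))=\mathrm{non}(\mathcal M_\kappa({}^{\mu}\mu,\mu))$.
   Context: For ordinals $\delta,\rho$, ${}^{\delta}\rho$ is the set of functions $\delta\to\rho$; for a partial function $s\colon\delta\rightharpoonup\rho$, $[s]=\{f\in{}^{\delta}\rho: s\subseteq f\}$. The ${<}\mu$-box topology on ${}^{\delta}\rho$ has base $\{[s]: |\mathrm{dom}(s)|<\mu\}$; $(X,\mu)$ denotes $X$ with it. A set is $\kappa$-meagre if it is a union of at most $\kappa$ nowhere dense sets; $\mathcal M_\kappa(X,\tau)$ is the ideal of $\kappa$-meagre subsets; $\mathrm{non}(\mathcal I)$ is the least size of a subset of the space not in $\mathcal I$. *)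

(* Defs.v *)
From HB Require Import structures.
From mathcomp Require Import all_boot all_order.
From mathcomp Require Import boolp classical_sets cardinality.
Set Implicit Arguments. Unset Strict Implicit. Unset Printing Implicit Defensive.
Local Open Scope classical_set_scope.
Local Open Scope card_scope.

(* A cardinal is represented by a carrier type [T] with a strict well-order
   [lt] making (T, lt) an initial ordinal: every proper initial segment has
   strictly smaller cardinality than T. *)
Definition strict_wellorder (T : Type) (lt : T -> T -> Prop) : Prop :=
  (forall x, ~ lt x x) /\
  (forall x y z, lt x y -> lt y z -> lt x z) /\
  (forall x y, x = y \/ lt x y \/ lt y x) /\
  well_founded lt.

Definition initial_ordinal (T : Type) (lt : T -> T -> Prop) : Prop :=
  strict_wellorder lt /\
  forall x : T, ~ ([set: T] #<= [set y | lt y x]).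

Definition cofinal (T : Type) (lt : T -> T -> Prop) (C : set T) : Prop :=
  forall x, exists c, C c /\ ~ lt c x.

Definition cf_is (T K : Type) (lt : T -> T -> Prop) : Prop :=
  (exists C : set T, cofinal lt C /\ C #= [set: K]) /\
  (forall C : set T, cofinal lt C -> [set: K] #<= C).

Definition regular_infinite (K : Type) (ltK : K -> K -> Prop) : Prop :=
  initial_ordinal ltK /\ infinite_set [set: K] /\ cf_is K ltK.

Definition singular (M K : Type) (ltM : M -> M -> Prop) : Prop :=
  cf_is K ltM /\ ~ ([set: M] #<= [set: K]).

Definition small (M : Type) (D : set M) : Prop := ~ ([set: M] #<= D).

(* basic open set [s] for the partial function s|D *)
Definition cyl (M R : Type) (D : set M) (s : M -> R) : set (M -> R) :=
  [set f | forall x, D x -> f x = s x].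

Definition box_open (M R : Type) (U : set (M -> R)) : Prop :=
  forall f, U f -> exists (D : set M) (s : M -> R),
    small D /\ cyl D s f /\ cyl D s `<=` U.

Definition box_closure (M R : Type) (N : set (M -> R)) : set (M -> R) :=
  [set f | forall U : set (M -> R), box_open U -> U f -> exists g, U g /\ N g].

Definition box_nowhere_dense (M R : Type) (N : set (M -> R)) : Prop :=
  forall U : set (M -> R), box_open U -> U `<=` box_closure N -> U = set0.

Definition kappa_meagre (K M R : Type) (A : set (M -> R)) : Prop :=
  exists N : K -> set (M -> R),
    (forall k, box_nowhere_dense (N k)) /\ A `<=` \bigcup_k N k.

(* mu^{<mu} = | union over alpha < mu of ^alpha mu | *)
Definition lt_mu_functions (M : Type) (ltM : M -> M -> Prop) : Type :=
  {x : M & {y : M | ltM y x} -> M}.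

(* Main.v *)
(* Fix a map [c] from kappa onto a cofinal subset of mu.  Bits on a small block
   L, repeated mu times, show that a nonmeagre A has at least 2^|L| elements, so
   |A| >= mu and |A| >= 2^kappa.  To obtain mu^|L| <= |A|, reserve for each k in
   kappa a block on which f may store many copies of the graph of a function
   h : L -> mu truncated at c(k), and let f guess h at k if a majority of these
   copies is correct.  For each j, the set of f not guessing h at any k with
   c(k) >= c(j) is nowhere dense, so every h is guessed cofinally often by some
   f in A; f and the set of those k determine h, whence
   mu^|L| <= |A| * 2^kappa = |A|.

   For the equality, composition with a surjection mu -> 2 sends nonmeagre sets
   to nonmeagre sets.  Conversely, if mu <= 2^lambda for some lambda < mu, then
   blocks of lambda bits code elements of mu; otherwise mu is a strong limit,
   mu^mu = 2^mu <= mu^kappa <= |A|, and the whole space is nonmeagre by the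
   Baire category theorem for kappa nowhere dense sets. *)
Require Import Defs.
From mathcomp Require Import all_boot all_order.
From mathcomp Require Import boolp classical_sets cardinality.
From mathcomp Require wochoice.
From Stdlib Require Inverse_Image.
Set Implicit Arguments. Unset Strict Implicit. Unset Printing Implicit Defensive.
Local Open Scope classical_set_scope.
Local Open Scope card_scope.

(** * Cardinal comparison of types *)

Definition embeds (S T : Type) : Prop := exists f : S -> T, injective f.

Lemma sval_inj (T : Type) (P : T -> Prop) : injective (@proj1_sig T P).
Proof. by move=> [x p] [y q] /= xy; apply: eq_exist. Qed.

Lemma embeds_refl T : embeds T T. Proof. by exists id. Qed.

Lemma embeds_trans S T U : embeds S T -> embeds T U -> embeds S U.
Proof. by move=> [f fI] [g gI]; exists (g \o f); apply: inj_comp. Qed.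

Lemma embeds_sub T (A B : T -> Prop) :
  (forall x, A x -> B x) -> embeds {x | A x} {x | B x}.
Proof.
move=> AB; exists (fun u => exist B (sval u) (AB _ (svalP u))).
by move=> u v /(congr1 sval) /= /sval_inj.
Qed.

Lemma embeds_sig T (P : T -> Prop) : embeds {x | P x} T.
Proof. by exists sval; apply: sval_inj. Qed.

Lemma embeds_prod S T S' T' :
  embeds S S' -> embeds T T' -> embeds (S * T) (S' * T').
Proof.
move=> [f fI] [g gI]; exists (fun p => (f p.1, g p.2)).
by move=> [a b] [c d] /= [/fI -> /gI ->].
Qed.

Lemma fun_choice S T (R : S -> T -> Prop) :
  (forall s, exists t, R s t) -> exists f, forall s, R s (f s).
Proof. by move=> H; exists (fun s => sval (cid (H s))) => s; apply: svalP. Qed.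

Lemma surj_embeds S T (f : S -> T) :
  (forall t, exists s, f s = t) -> embeds T S.
Proof. by move=> /fun_choice[g gK]; exists g; apply: can_inj gK. Qed.

Lemma partial_inverse S T (e : S -> T) : injective e ->
  exists q : T -> option S, forall t s, q t = Some s <-> e s = t.
Proof.
move=> eI; suff /fun_choice : forall t, exists o, forall s, o = Some s <-> e s = t by [].
move=> t.
have [[s es]|nes] := pselect (exists s, e s = t).
  by exists (Some s) => s'; split=> [[<-]//|es']; congr Some; apply: eI; rewrite es es'.
by exists None => s; split=> // es; case: nes; exists s.
Qed.

(** Later embeddings are given as relations in which each target has at most one source; choice then
    yields the injection, and elements of subset types need not be computed. *)
Lemma embeds_cover S T (f : S -> T -> Prop) :
  (forall s, exists t, f s t) -> (forall s s' t, f s t -> f s' t -> s = s') ->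
  embeds S T.
Proof.
by move=> /fun_choice[g gP] fI; exists g => s s' e; apply: (fI _ _ (g s)); rewrite // e.
Qed.

Lemma embeds_fun S S' T : embeds S S' -> T -> embeds (S -> T) (S' -> T).
Proof.
move=> [e eI] t0; have [q qP] := partial_inverse eI.
exists (fun f s' => if q s' is Some s then f s else t0) => f g fg.
apply/funext => s; have /(congr1 (@^~ (e s))) := fg.
by rewrite /= (qP (e s) s).2.
Qed.

Lemma Cantor T : ~ embeds (T -> bool) T.
Proof.
move=> [e eI]; have [q qP] := partial_inverse eI.
pose d t := if q t is Some p then ~~ p t else true.
have := (qP (e d) d).2 erefl => qd.
have : d (e d) = ~~ d (e d) by rewrite {1}/d qd.
by case: (d (e d)).
Qed.

Lemma card_leE T U (A : set T) (B : set U) :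
  A #<= B <-> embeds {x | A x} {x | B x}.
Proof.
split.
- move=> /card_leP/injfunPex[f _ fI].
  exists (fun u => let v := f (SigSub (mem_set (svalP u))) in
    exist B (val v) (set_mem (valP v))).
  move=> u v /(congr1 sval) /= /val_inj/fI E; apply: sval_inj.
  by have /(congr1 val) := E (mem_set I) (mem_set I).
- move=> [f fI]; apply/card_leP.
  pose g (a : set_type A) : set_type B :=
    let v := f (exist A (val a) (set_mem (valP a))) in SigSub (mem_set (svalP v)).
  have gI : {in [set: set_type A] &, injective g}.
    move=> a b _ _ /(congr1 val) /= /sval_inj /fI /(congr1 sval) /= /val_inj //.
  by apply/injfunPex; exists g.
Qed.

Lemma embeds_setT T : embeds T {x | [set: T] x}.
Proof. by exists (fun x => exist [set: T] x I) => x y /(congr1 sval). Qed.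

Lemma card_leTE T U (B : set U) : [set: T] #<= B <-> embeds T {x | B x}.
Proof.
rewrite card_leE; split; apply: embeds_trans; first exact: embeds_setT.
exact: embeds_sig.
Qed.

Lemma card_leTTE T U : [set: T] #<= [set: U] <-> embeds T U.
Proof.
rewrite card_leTE; split=> /embeds_trans; apply; first exact: embeds_sig.
exact: embeds_setT.
Qed.

(** * Well-ordered recursion and the square of an infinite cardinal *)

Lemma wf_rec W (lt : W -> W -> Prop) X
    (step : forall w, ({v | lt v w} -> X) -> X) : well_founded lt ->
  exists g : W -> X, forall w, g w = step w (fun v => g (sval v)).
Proof.
move=> wf.
pose F w (r : forall v, lt v w -> X) := step w (fun v => r (sval v) (svalP v)).
exists (Fix wf (fun=> X) F) => w; rewrite Fix_eq // => x f g fg.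
by congr (step _ _); apply/funext => v; apply: fg.
Qed.

(** Each [w] receives by recursion a value not taken below it; one is left, since otherwise the
    segment below [w] would map onto [X]. *)
Lemma embeds_wf W (lt : W -> W -> Prop) X : well_founded lt ->
  (forall v w, v = w \/ lt v w \/ lt w v) ->
  (forall w, ~ embeds X {v | lt v w}) -> embeds W X.
Proof.
move=> wf tri seg.
have new w (r : {v | lt v w} -> X) : exists x, forall v, r v <> x.
  apply: contrapT => H; apply: (seg w); apply: (surj_embeds (f := r)) => x.
  by apply: contrapT => H'; apply: H; exists x => v rv; apply: H'; exists v.
have [g gE] := wf_rec (fun w r => sval (cid (new w r))) wf.
have gN v w : lt v w -> g v <> g w.
  move=> vw; rewrite [g w]gE.
  exact: (svalP (cid (new w (fun v => g (sval v)))) (exist _ v vw)).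
exists g => v w gvw; have [//|[/gN //|/gN]] := tri v w; congruence.
Qed.

Lemma wellorder_exists T : exists lt : T -> T -> Prop, strict_wellorder lt.
Proof.
elim/Pchoice: T => T; have [R Rwo] := wochoice.well_ordering_principle T.
have minR (P : T -> Prop) x : P x ->
    exists2 z, P z & forall y, P y -> R z y.
  move=> Px; have [|z [[zP zmin] _]] := Rwo [pred y | `[< P y >]].
    by exists x; apply/asboolP.
  by exists z; [exact/asboolP|move=> y Py; apply: zmin; apply/asboolP].
have Rchain : wochoice.wo_chain R predT by move=> A _; apply: Rwo.
have anti x y : R x y -> R y x -> x = y.
  move=> xy yx; apply: (wochoice.wo_chain_antisymmetric Rchain) => //.
  by rewrite xy yx.
have tot x y : R x y || R y x by apply: (wochoice.wo_chainW Rchain).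
pose lt x y : Prop := ~~ R y x.
have wf : well_founded lt.
  move=> x; apply: contrapT => /(minR (fun x => ~ Acc lt x))[z nz zmin].
  by apply: nz; constructor => y /negP yz; apply: contrapT => /zmin.
have asym x y : lt x y -> ~ lt y x.
  rewrite /lt => /negbTE xy; have := tot x y; rewrite xy orbF => ->//.
exists lt; split; last split; last split => //.
- by move=> x xx; apply: (asym x x).
- move=> x y z xy yz.
  (* Take the [R]-least of the three: least [y] or [z] contradicts [xy] or [yz]; if [x] is least,
     [R z x] would give [z = x] and contradict [yz]. *)
  have [w + wmin] := minR (fun u => [\/ u = x, u = y | u = z]) z (Or33 _ _ erefl).
  case=> ew; rewrite {}ew in wmin; rewrite /lt in xy yz *.
  + apply/negP => zx; move/negP: yz; apply.
    suff -> : z = x by apply: wmin; apply: Or32.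
    by apply: anti => //; apply: wmin; apply: Or33.
  + by move/negP: xy => []; apply: wmin; apply: Or31.
  + by move/negP: yz => []; apply: wmin; apply: Or32.
- move=> x y; have [xy|] := boolP (R x y); last by right; right.
  by have [yx|] := boolP (R y x); [left; apply: anti|right; left].
Qed.

Lemma embeds_total S T : embeds S T \/ embeds T S.
Proof.
have [lt [_ [_ [tri wf]]]] := wellorder_exists S.
have [[w Tw]|H] := pselect (exists w, embeds T {v | lt v w}).
  by right; apply: embeds_trans Tw (embeds_sig _).
by left; apply: (embeds_wf wf tri) => w Tw; apply: H; exists w.
Qed.

Lemma embeds_nat_prod S : embeds nat (S * S) -> embeds nat S.
Proof.
move=> /card_leTTE/infiniteP iSS; apply/card_leTTE/infiniteP => fS.
by apply: iSS; rewrite -setXTT; apply: finite_setX.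
Qed.

(** Hilbert's hotel: [None] takes the place of [e 0], and the copy of [nat] moves up by one. *)
Lemma embeds_option T : embeds nat T -> embeds (option T) T.
Proof.
move=> [e eI]; have [q qP] := partial_inverse eI.
exists (fun o => if o is Some t then if q t is Some n then e n.+1 else t else e 0).
have qe n : q (e n) = Some n by apply/qP.
move=> [s|] [t|] //=.
- case qs: (q s) => [m|]; case qt: (q t) => [n|].
  + by move=> /eI [mn]; move/qP: qs => <-; move/qP: qt => <-; rewrite mn.
  + by move=> /qP; rewrite qt.
  + by move=> /esym/qP; rewrite qs.
  + by move=> ->.
- case qs: (q s) => [m|]; first by move/eI.
  by move=> /esym/qP; rewrite qs.
- case qs: (q t) => [m|]; first by move/eI.
  by move=> /qP; rewrite qs.
Qed.

Lemma embeds_nat_option S : embeds nat (option S) -> embeds nat S.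
Proof.
move=> [f fI].
have [N fN] : exists N, forall n, exists s, f (N + n)%N = Some s.
  have [[N fN]|nN] := pselect (exists N, f N = None).
    exists N.+1 => n; case e: (f _) => [s|]; first by exists s.
    by move: e; rewrite -fN => /fI /eqP; rewrite addSnnS -{2}[N]addn0 eqn_add2l.
  by exists 0 => n; case e: (f _) => [s|]; [exists s|case: nN; exists (0 + n)].
have [g gE] := fun_choice fN; exists g => m n gmn.
by apply: (@addnI N); apply: fI; rewrite !gE gmn.
Qed.

Lemma embeds_under T (lt : T -> T -> Prop) m : strict_wellorder lt ->
  embeds {y | ~ lt m y} (option {y | lt y m}).
Proof.
move=> [_ [_ [tri _]]].
exists (fun u => if pselect (lt (sval u) m) is left p
  then Some (exist (fun y => lt y m) _ p) else None) => u v.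
case: pselect => [p|np]; case: pselect => [q|nq] //.
  by move=> -[/sval_inj].
move=> _; apply: sval_inj.
have [-> | [//|/(svalP u)//]] := tri (sval u) m.
by have [-> | [//|/(svalP v)//]] := tri (sval v) m.
Qed.

(** * Hessenberg's theorem: an infinite cardinal equals its square *)

Section Square.
Context (T : Type) (lt : T -> T -> Prop) (wo : strict_wellorder lt).

Let lt_irr x : ~ lt x x. Proof. exact: wo.1. Qed.
Let lt_trans x y z : lt x y -> lt y z -> lt x z. Proof. exact: wo.2.1. Qed.
Let lt_tri x y : x = y \/ lt x y \/ lt y x. Proof. exact: wo.2.2.1. Qed.
Let lt_wf : well_founded lt. Proof. exact: wo.2.2.2. Qed.

Let mx a b := if `[< lt a b >] then b else a.

Let mxP a b : ~ lt (mx a b) a /\ ~ lt (mx a b) b.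
Proof.
rewrite /mx; case: asboolP => [ab|]; split=> // ba.
by apply: (@lt_irr a); apply: lt_trans ba.
Qed.

(* Goedel's ordering of pairs: by maximum, then lexicographically. *)
Let pair_lt p q := lt (mx p.1 p.2) (mx q.1 q.2) \/
  (mx p.1 p.2 = mx q.1 q.2 /\
    (lt p.1 q.1 \/ (p.1 = q.1 /\ lt p.2 q.2))).

Let pair_wf : well_founded pair_lt.
Proof.
suff H m : forall a b, mx a b = m -> Acc pair_lt (a, b) by move=> [a b]; apply: H.
elim/(well_founded_induction lt_wf): m => m IHm a.
elim/(well_founded_induction lt_wf): a => a IHa b.
elim/(well_founded_induction lt_wf): b => b IHb abm.
constructor=> -[a' b'] /= [|[mm [aa|[/= ea bb]]]]; rewrite ?abm.
- by move=> /IHm; apply.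
- by apply: (IHa a' aa); rewrite mm.
- by subst a'; apply: IHb bb _; rewrite mm.
Qed.

Let pair_tri p q : p = q \/ pair_lt p q \/ pair_lt q p.
Proof.
case: p q => [a b] [c d]; rewrite /pair_lt /=.
have [m|[m|m]] := lt_tri (mx a b) (mx c d); [|by tauto|by tauto].
have m' := esym m; have [ac|[ac|ac]] := lt_tri a c; [subst c| |by tauto].
- have [->|[bd|bd]] := lt_tri b d; [by left|by tauto|by tauto].
- by tauto.
Qed.

(** In Goedel's ordering the pairs below [(c, d)] lie in the square of the closed segment up to
    [mx c d], which is too small to contain [X]; so [embeds_wf] applies. The predicate [X] covers
    both proper segments and the whole type. *)
Lemma square_step (X : T -> Prop) :
  (forall x y, X x -> lt y x -> X y) ->
  (forall m, X m -> ~ embeds {x | X x} {y | lt y m}) ->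
  (forall m, X m -> embeds nat {y | lt y m} ->
    embeds ({y | lt y m} * {y | lt y m}) {y | lt y m}) ->
  embeds nat {x | X x} -> embeds ({x | X x} * {x | X x}) {x | X x}.
Proof.
move=> Xd Xinit Xsq Xinf.
pose under m := {y | ~ lt m y}.
have under_opt m : embeds (under m) (option {y | lt y m}) by apply: embeds_under.
have under_sq m : X m -> ~ embeds {x | X x} (under m * under m).
  move=> Xm Xu.
  (* If [X] embedded in this square, the segment below [m] would be infinite, hence absorb both the
     endpoint and the square, against [Xinit]. *)
  have := embeds_nat_prod (embeds_trans Xinf Xu) => /embeds_trans/(_ (under_opt m)).
  have [nm _|nm] := pselect (embeds nat {y | lt y m}).
    have um := embeds_trans (under_opt m) (embeds_option nm).
    apply: (Xinit m Xm); apply: embeds_trans Xu _.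
    exact: embeds_trans (embeds_prod um um) (Xsq m Xm nm).
  by move=> /embeds_nat_option.
pose plt (p q : {x | X x} * {x | X x}) :=
  pair_lt (sval p.1, sval p.2) (sval q.1, sval q.2).
apply: (@embeds_wf _ plt).
- have := Inverse_Image.wf_inverse_image _ _ pair_lt
    (fun p : {x | X x} * {x | X x} => (sval p.1, sval p.2)) pair_wf.
  exact.
- move=> [a b] [c d]; rewrite /plt /=.
  have [[/sval_inj-> /sval_inj->]|] := pair_tri (sval a, sval b) (sval c, sval d).
    by left.
  by right.
- move=> [c d] /embeds_trans H.
  have Xm : X (mx (sval c) (sval d)).
    by rewrite /mx; case: ifP => _; apply: svalP.
  apply: (under_sq _ Xm); apply: H.
  have le2 (p : {p | plt p (c, d)}) :
      ~ lt (mx (sval c) (sval d)) (sval (sval p).1) /\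
      ~ lt (mx (sval c) (sval d)) (sval (sval p).2).
    case: p => -[a b] /= pl.
    have [m1 m2] := mxP (sval a) (sval b).
    have le : ~ lt (mx (sval c) (sval d)) (mx (sval a) (sval b)).
      case: pl => /= [pl pl'|[-> _]]; last exact: lt_irr.
      exact: lt_irr (lt_trans pl pl').
    have key x : ~ lt (mx (sval a) (sval b)) x -> ~ lt (mx (sval c) (sval d)) x.
      move=> nx cx; have [e|[l|l]] := lt_tri x (mx (sval a) (sval b)).
      - by apply: le; rewrite -e.
      - by apply: le; apply: lt_trans cx l.
      - exact: nx.
    by split; apply: key.
  exists (fun p => (exist (fun y => ~ lt (mx (sval c) (sval d)) y) _ (le2 p).1,
                    exist (fun y => ~ lt (mx (sval c) (sval d)) y) _ (le2 p).2)).
  move=> [[a b] p] [[a' b'] p'] /= [/sval_inj ea /sval_inj eb].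
  by apply: eq_exist; rewrite ea eb.
Qed.

End Square.

Lemma embeds_square T : embeds nat T -> embeds (T * T) T.
Proof.
move=> Tinf; have [lt wo] := wellorder_exists T.
have [irr [tr [tri wf]]] := wo.
have seg x : embeds nat {y | lt y x} ->
    embeds ({y | lt y x} * {y | lt y x}) {y | lt y x}.
  elim/(well_founded_induction wf): x => x IH xinf.
  (* A segment that embeds in a shorter one inherits the claim from it; otherwise it is an initial
     ordinal and [square_step] applies. *)
  have [[m mx xm]|ninit] :=
    pselect (exists2 m, lt m x & embeds {y | lt y x} {y | lt y m}).
    apply: embeds_trans (embeds_prod xm xm) _.
    apply: embeds_trans (IH m mx (embeds_trans xinf xm)) _.
    by apply: embeds_sub => y ym; apply: tr ym mx.
  apply: (square_step wo) => //.
  - by move=> y z yx zy; apply: tr zy yx.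
  - by move=> m mx xm; apply: ninit; exists m.
have [[m Tm]|ninit] := pselect (exists m, embeds T {y | lt y m}).
  apply: embeds_trans (embeds_prod Tm Tm) _.
  exact: embeds_trans (seg m (embeds_trans Tinf Tm)) (embeds_sig _).
have TT : embeds {x | [set: T] x} T by apply: embeds_sig.
have TT' := embeds_setT T.
apply: embeds_trans (embeds_prod TT' TT') (embeds_trans _ TT).
apply: (square_step wo) => //.
- by move=> m _ Tm; apply: ninit; exists m; exact: embeds_trans TT' Tm.
- by move=> m _; apply: seg.
- exact: embeds_trans Tinf TT'.
Qed.

(** * Small sets and nowhere dense sets *)

Section Small.
Context (M : Type) (Minf : embeds nat M).

(** By comparability of cardinals this says |S| < |M|. *)
Definition smallT (S : Type) : Prop := ~ embeds M S.

Lemma smallE (D : set M) : small D <-> smallT {x | D x}.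
Proof. by rewrite /small card_leTE. Qed.

Lemma smallT_le S T : embeds S T -> smallT T -> smallT S.
Proof. by move=> ST T_small MS; apply/T_small/(embeds_trans MS). Qed.

Lemma smallT_embeds S : smallT S -> embeds S M.
Proof. by move=> sS; have [|/sS] := embeds_total S M. Qed.

Lemma smallT_square S : smallT S -> smallT (S * S).
Proof.
move=> sS MSS; have nS := embeds_nat_prod (embeds_trans Minf MSS).
exact/sS/(embeds_trans MSS)/embeds_square.
Qed.

Lemma smallT_prod S T : smallT S -> smallT T -> smallT (S * T).
Proof.
move=> sS sT; have [ST|TS] := embeds_total S T.
  by apply: smallT_le (smallT_square sT); apply: embeds_prod ST (embeds_refl _).
by apply: smallT_le (smallT_square sS); apply: embeds_prod (embeds_refl _) TS.
Qed.

Lemma smallT_option S : smallT S -> smallT (option S).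
Proof.
move=> sS MS; have nS := embeds_nat_option (embeds_trans Minf MS).
exact/sS/(embeds_trans MS)/embeds_option.
Qed.

Lemma smallT_bool : smallT bool.
Proof.
move=> /(embeds_trans Minf) [f fI].
have [f01 f02 f12] : [/\ f 0 <> f 1, f 0 <> f 2 & f 1 <> f 2] by split=> /fI.
by case: (f 0) (f 1) (f 2) f01 f02 f12 => -[] [].
Qed.

Lemma small_setU (D D' : set M) : small D -> small D' -> small (D `|` D').
Proof.
rewrite !smallE => sD sD'; pose S := (option {x | D x} * option {x | D' x})%type.
apply: (@smallT_le _ S); last by apply: smallT_prod; apply: smallT_option.
apply: (@embeds_cover _ _ (fun u p =>
  (exists d, sval u = sval d /\ p = (Some d, None)) \/
  (exists d, sval u = sval d /\ p = (None, Some d)))).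
- move=> [x [Dx|Dx]].
    by exists (Some (exist D x Dx), None); left; exists (exist D x Dx).
  by exists (None, Some (exist D' x Dx)); right; exists (exist D' x Dx).
- move=> u v p [[d [ud ->]]|[d [ud ->]]] [[d' [vd]]|[d' [vd]]] //.
  + by move=> [dd']; apply: sval_inj; rewrite ud vd dd'.
  + by move=> [dd']; apply: sval_inj; rewrite ud vd dd'.
Qed.

Lemma small_image S (f : S -> M) : smallT S -> small [set z | exists s, z = f s].
Proof.
move=> sS; apply/smallE; apply: smallT_le sS.
apply: (@embeds_cover _ _ (fun u s => sval u = f s)).
  by move=> [z [s zs]]; exists s.
by move=> u v s us vs; apply: sval_inj; rewrite us vs.
Qed.

(** If every extension of [s] met [N], the cylinder of [s] would be a nonempty open set inside the
    closure of [N]. Supports can be merged because a union of two small sets is small. *)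
Lemma nwdP R (N : set (M -> R)) : box_nowhere_dense N <->
  forall D s, small D -> exists D' s', [/\ small D', D `<=` D',
    forall x, D x -> s' x = s x & forall f, cyl D' s' f -> ~ N f].
Proof.
split=> [Nnd D s sD|H U oU UN].
- apply: contrapT => H.
  suff e : cyl D s = set0 by have [] : set0 s by rewrite -e.
  apply: Nnd => [f sf|f sf V oV Vf]; first by exists D, s; split=> //; split.
  apply: contrapT => VN; apply: H.
  have [E [t [sE [tf EV]]]] := oV f Vf.
  exists (D `|` E), f; split=> //; first exact: small_setU.
  move=> g gf Ng; apply: VN; exists g; split=> //.
  by apply: EV => x Ex; rewrite gf ?tf //; right.
- apply/seteqP; split=> // f Uf.
  have [D [s [sD [sf DU]]]] := oU f Uf.
  have [D' [s' [sD' DD' s's s'N]]] := H D s sD.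
  have Us' : U s' by apply: DU.
  have [|g [gs' Ng]] := UN s' Us' (cyl D' s') _ (fun _ _ => erefl).
    by move=> g gs'; exists D', s'; split=> //; split.
  exact: s'N gs' Ng.
Qed.

Definition override R (D : set M) (s t : M -> R) (x : M) : R :=
  if pselect (D x) then s x else t x.

Lemma overrideT R D (s t : M -> R) x : D x -> override D s t x = s x.
Proof. by rewrite /override; case: pselect. Qed.

Lemma overrideF R D (s t : M -> R) x : ~ D x -> override D s t x = t x.
Proof. by rewrite /override; case: pselect. Qed.

(** New values [t] may be prescribed on any small [E], overlapping [D] or not: on the overlap the
    old condition wins. *)
Lemma nwd_override R (N : set (M -> R)) :
  (forall D s, small D -> exists E t, small E /\
    forall f, cyl D s f -> cyl E (override D s t) f -> ~ N f) ->
  box_nowhere_dense N.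
Proof.
move=> H; apply/nwdP => D s sD; have [E [t [sE HE]]] := H D s sD.
exists (D `|` E), (override D s t); split.
- exact: small_setU.
- by left.
- by move=> x Dx; rewrite overrideT.
- move=> f fc; apply: HE => x Dx; last by apply: fc; right.
  by rewrite fc ?overrideT //; left.
Qed.

Lemma nonmeagre_image K R R' (phi : (M -> R) -> (M -> R')) (B : set (M -> R)) :
  (forall N, box_nowhere_dense N -> box_nowhere_dense (phi @^-1` N)) ->
  ~ kappa_meagre K B -> ~ kappa_meagre K (phi @` B).
Proof.
move=> phiN nB [N [Nnd BN]]; apply: nB; exists (fun k => phi @^-1` N k).
split=> [k|f Bf]; first exact/phiN/Nnd.
by have [k _ Nk] := BN (phi f) (imageP _ Bf); exists k.
Qed.

(** Otherwise in each block [a] some pattern [x a] is realised by no member of [A]. The functions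
    that avoid [x a] in every block form a nowhere dense set, as a small [D] leaves some block
    untouched, and this set contains [A]. *)
Lemma nonmeagre_pow K (A : set (M -> bool)) L (k0 : K) :
  ~ kappa_meagre K A -> smallT L -> embeds (L -> bool) {f | A f}.
Proof.
move=> nA sL; apply: contrapT => nLA; apply: nA.
have [e eI] : embeds (M * L) M.
  apply: embeds_trans (embeds_square Minf).
  exact: embeds_prod (embeds_refl _) (smallT_embeds sL).
have [q qP] := partial_inverse eI.
have [x xP] : exists x : M -> L -> bool,
    forall a f, A f -> exists l, f (e (a, l)) <> x a l.
  suff /fun_choice : forall a, exists x : L -> bool,
    forall f, A f -> exists l, f (e (a, l)) <> x l by [].
  move=> a; apply: contrapT => nx; apply: nLA.
  apply: (@surj_embeds _ _ (fun f l => sval f (e (a, l)))) => x.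
  apply: contrapT => nf; apply: nx; exists x => f Af.
  apply: contrapT => nl; apply: nf; exists (exist A f Af).
  by apply/funext => l /=; apply: contrapT => fl; apply: nl; exists l.
exists (fun=> [set f | forall a, exists l, f (e (a, l)) <> x a l]); split; last first.
  by move=> f Af; exists k0 => // a; apply: xP.
move=> _; apply: nwd_override => D s sD.
have [a aD] : exists a, forall l, ~ D (e (a, l)).
  apply: contrapT => H; move/smallE: sD; apply.
  apply: (@embeds_cover _ _ (fun a d => exists l, sval d = e (a, l))).
    move=> a; apply: contrapT => H'; apply: H; exists a => l Dl.
    by apply: H'; exists (exist D _ Dl), l.
  by move=> a a' d [l ->] [l' /eI[]].
exists [set z | exists l, z = e (a, l)],
  (fun z => if q z is Some (a, l) then x a l else false).
split; first exact: small_image.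
move=> f _ fE /(_ a)[l]; apply; rewrite fE; last by exists l.
by rewrite overrideF // (qP _ (a, l)).2.
Qed.

Lemma nonmeagre_large K (A : set (M -> bool)) (k0 : K) :
  ~ kappa_meagre K A -> embeds M {f | A f}.
Proof.
(* The block is [A] itself: if |A| < |M|, then 2^|A| would be at most |A|. *)
move=> nA; apply: contrapT => /(nonmeagre_pow k0 nA); exact: Cantor.
Qed.

End Small.

(** Two majorities meet: if [Z] and [Z'] covered [X], two copies of the larger one would be enough
    to contain [X]. *)
Lemma avoid_both X (Z Z' : X -> Prop) :
  ~ embeds X ({x | Z x} * bool) -> ~ embeds X ({x | Z' x} * bool) ->
  exists x, ~ Z x /\ ~ Z' x.
Proof.
wlog [i iI] : Z Z' / embeds {x | Z x} {x | Z' x} => [H nZ nZ'|_ nZ'].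
  have [ZZ|ZZ] := embeds_total {x | Z x} {x | Z' x}; first exact: H.
  by have [x []] := H _ _ ZZ nZ' nZ; exists x.
apply: contrapT => H; apply: nZ'.
apply: (@embeds_cover _ _ (fun x p =>
  (exists z : {x | Z' x}, x = sval z /\ p = (z, true)) \/
  (exists z : {x | Z x}, x = sval z /\ p = (i z, false)))).
- move=> x; have [Zx|nZx] := pselect (Z x).
    by exists (i (exist Z x Zx), false); right; exists (exist Z x Zx).
  have [Zx|nZx'] := pselect (Z' x); last by case: H; exists x.
  by exists (exist Z' x Zx, true); left; exists (exist Z' x Zx).
- move=> x y p [[z [-> ->]]|[z [-> ->]]] [[z' [->]]|[z' [->]]] //.
    by move=> [->].
  by move=> [/iI ->].
Qed.

(** * The lower bound *)

Section SingularCofinality.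
Context (K M : Type) (ltM : M -> M -> Prop) (c : K -> M).
Context (Minf : embeds nat M) (Mwo : strict_wellorder ltM).
Context (Minit : forall x, smallT M {y | ltM y x}).
Context (Ksmall : smallT M K) (c_cofinal : forall x, exists k, ~ ltM (c k) x).

Local Notation under x := {y | ~ ltM x y}.

Lemma smallT_under x : smallT M (under x).
Proof.
apply: smallT_le (embeds_under x Mwo) _.
exact: smallT_option.
Qed.

Lemma under_le x y z : ~ ltM x y -> ~ ltM y z -> ~ ltM x z.
Proof.
have [irr [tr [tri _]]] := Mwo.
move=> xy yz xz; have [e|[//|yx]] := tri x y; first by apply: yz; rewrite -e.
by apply: yz; apply: tr yx xz.
Qed.

(** Otherwise all these segments embed in [S], and since they cover [M], [M] embeds in [K * S], a
    product of two small types. *)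
Lemma small_block j S : smallT M S ->
  exists k, ~ ltM (c k) (c j) /\ ~ embeds (under (c k)) S.
Proof.
move=> sS; apply: contrapT => H; apply: (smallT_prod Minf Ksmall sS).
have G (u : {k | ~ ltM (c k) (c j)}) :
    exists g : under (c (sval u)) -> S, injective g.
  by apply: contrapT => nu; apply: H; exists (sval u); split; first exact: (svalP u).
have [g gI] : exists g : forall u : {k | ~ ltM (c k) (c j)}, under (c (sval u)) -> S,
    forall u, injective (g u).
  by exists (fun u => sval (cid (G u))) => u; apply: svalP (cid (G u)).
apply: (@embeds_cover _ _ (fun x p => exists u (xu : ~ ltM (c (sval u)) x),
  p = (sval u, g u (exist _ x xu)))).
- move=> x; have [k kx] := c_cofinal x.
  (* If the chosen [c k] is below [c j], the index [j] itself serves for [x]. *)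
  have [kj|kj] := pselect (ltM (c k) (c j)); last first.
    by eexists; exists (exist (fun k => ~ ltM (c k) (c j)) k kj), kx.
  have jj : ~ ltM (c j) (c j) by apply: Mwo.1.
  have jx : ~ ltM (c j) x.
    by move=> jx; apply: kx; apply: Mwo.2.1 jx.
  by eexists; exists (exist (fun k => ~ ltM (c k) (c j)) j jj), jx.
- move=> x y p [u [xu ->]] [v [yv [/sval_inj uv]]].
  by subst v => /gI [].
Qed.

(** * Guessing functions by a majority of copies *)

Section Guess.
Context (L : Type) (e : K * M * L * M -> M) (eI : injective e).

(* The block [k] of [f] is a family, indexed by the [x] below [c k], of
   approximations to the graph of a function [L -> M] below [c k]; the block
   guesses [h] if most of its members are correct. *)
Definition guesses (f : M -> bool) (h : L -> M) (k : K) : Prop :=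
  ~ embeds (under (c k))
      ({x : under (c k) | exists l y,
          ~ ltM (c k) y /\ f (e (k, sval x, l, y)) <> `[< h l = y >]} * bool).

(** Some copy is correct for both functions by [avoid_both]; it is read at [(l, h l)], which the
    truncation at [c k] retains. *)
Lemma guesses_eq f h h' k l : guesses f h k -> guesses f h' k ->
  ~ ltM (c k) (h l) -> h l = h' l.
Proof.
move=> fh fh' kl; apply: contrapT => hl.
have [x [xh xh']] := avoid_both fh fh'.
have E : f (e (k, sval x, l, h l)) = `[< h l = h l >].
  by apply: contrapT => ne; apply: xh; exists l, (h l).
have E' : f (e (k, sval x, l, h l)) = `[< h' l = h l >].
  by apply: contrapT => ne; apply: xh'; exists l, (h l).
by move: E; rewrite E' (asboolT (erefl (h l))) => /asboolP /esym.
Qed.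

(** Choose a block with more copies than twice |D| and write the graph of [h] there outside [D].
    Each incorrect copy then contains a point of [D], so the incorrect copies are too few to prevent
    a guess. *)
Lemma nwd_not_guesses h j : smallT M L ->
  box_nowhere_dense [set f | forall k, ~ ltM (c k) (c j) -> ~ guesses f h k].
Proof.
move=> sL; apply: (nwd_override Minf) => D s /smallE sD.
have [k [kj kD]] := small_block j (smallT_prod Minf sD (smallT_bool Minf)).
have [q qP] := partial_inverse eI.
exists [set z | exists p : under (c k) * L * under (c k),
    z = e (k, sval p.1.1, p.1.2, sval p.2)],
  (fun z => if q z is Some (_, _, l, y) then `[< h l = y >] else false).
split.
  apply: small_image; apply: smallT_prod => //; last exact: smallT_under.
  by apply: smallT_prod => //; apply: smallT_under.
move=> f _ fE /(_ k kj); apply => kZ; apply: kD; apply: embeds_trans kZ _.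
apply: embeds_prod (embeds_refl _).
apply: (@embeds_cover _ _ (fun x d => exists l y,
  sval d = e (k, sval (sval x), l, y))).
- move=> [x [l [y [ky fxy]]]]; apply: contrapT => H; apply: (fxy).
  have nD : ~ D (e (k, sval x, l, y)).
    by move=> Dz; apply: H; exists (exist D _ Dz), l, y.
  rewrite fE; last by exists (x, l, exist _ y ky).
  by rewrite overrideF // (qP _ (k, sval x, l, y)).2.
- move=> x x' d [l [y ->]] [l' [y' /eI [xx' _ _]]].
  exact/sval_inj/sval_inj.
Qed.

End Guess.

Lemma nonmeagre_fun (A : set (M -> bool)) L (k0 : K) :
  ~ kappa_meagre K A -> smallT M L -> embeds (L -> M) {f | A f}.
Proof.
move=> nA sL.
have [e eI] : embeds (K * M * L * M) M.
  have MM := embeds_square Minf.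
  have step S T : embeds S M -> embeds T M -> embeds (S * T) M.
    by move=> SM TM; apply: embeds_trans (embeds_prod SM TM) MM.
  have [KM LM] := (smallT_embeds Ksmall, smallT_embeds sL).
  have rM := embeds_refl M.
  exact: step (step _ _ (step _ _ KM rM) LM) rM.
have guessed (h : L -> M) : exists f : {f | A f},
    forall j, exists k, ~ ltM (c k) (c j) /\ guesses e (sval f) h k.
  apply: contrapT => H; apply: nA.
  exists (fun j => [set f | forall k, ~ ltM (c k) (c j) -> ~ guesses e f h k]).
  split=> [j|f Af]; first exact: nwd_not_guesses.
  apply: contrapT => nf; apply: H; exists (exist A f Af) => j.
  apply: contrapT => nk; apply: nf; exists j => // k kj fk.
  by apply: nk; exists k.
have [F FP] := fun_choice guessed.
have MA := nonmeagre_large Minf k0 nA.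
apply: embeds_trans (embeds_square (embeds_trans Minf MA)).
apply: embeds_trans (embeds_prod (embeds_refl _) (nonmeagre_pow Minf k0 nA Ksmall)).
exists (fun h => (F h, fun k => `[< guesses e (sval (F h)) h k >])).
move=> h h' [FF gg]; apply/funext => l.
(* The value [h l] is recovered at a guessing index [k] with h(l) <= c(j) <= c(k). *)
have [j jl] := c_cofinal (h l); have [k [kj gk]] := FP h j.
apply: (guesses_eq (e := e) gk); last exact: under_le kj jl.
by rewrite FF; apply/asboolP; rewrite -(congr1 (@^~ k) gg); apply/asboolP.
Qed.

Lemma nonmeagre_lt_mu (A : set (M -> bool)) (k0 : K) :
  ~ kappa_meagre K A -> embeds (lt_mu_functions ltM) {f | A f}.
Proof.
move=> nA; have MA := nonmeagre_large Minf k0 nA.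
apply: embeds_trans (embeds_square (embeds_trans Minf MA)).
apply: embeds_trans (embeds_prod MA (embeds_refl _)).
have H x := nonmeagre_fun k0 nA (@Minit x).
exists (fun u => (projT1 u, sval (cid (H (projT1 u))) (projT2 u))).
move=> [x h] [y h'] /= [xy]; subst y.
by move=> /(svalP (cid (H x))) ->.
Qed.

End SingularCofinality.

(** * Baire category and the equality *)

Section Baire.
Context (K M : Type) (ltK : K -> K -> Prop) (ltM : M -> M -> Prop) (c : K -> M).
Context (Minf : embeds nat M) (Mwo : strict_wellorder ltM).
Context (Minit : forall x, smallT M {y | ltM y x}).
Context (Ksmall : smallT M K) (c_cofinal : forall x, exists k, ~ ltM (c k) x).
Context (Kwo : strict_wellorder ltK).
Context (Kinit : forall k, ~ embeds K {j | ltK j k}).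
Context (Kcf : forall C : set M, cofinal ltM C -> embeds K {x | C x}).

(** Fewer than cf(mu) sizes below mu have a common bound [x] below mu, so the union embeds in the
    product of two small segments. *)
Lemma small_union_below k (D : {j | ltK j k} -> set M) :
  (forall v, small (D v)) -> small [set x | exists v, D v x].
Proof.
move=> sD; have [irr [tr [tri _]]] := Mwo.
have bound v : exists x, embeds {y | D v y} {y | ~ ltM x y}.
  have /smallE sDv := sD v.
  have [k' [_ nk']] := small_block Minf Mwo Ksmall c_cofinal k sDv.
  by exists (c k'); have [//|/nk'] := embeds_total {y | D v y} {y | ~ ltM (c k') y}.
have [m mP] := fun_choice bound.
have [x mx] : exists x, forall v, ltM (m v) x.
  apply: contrapT => nx; apply: (@Kinit k).
  apply: (embeds_trans (Kcf (C := [set y | exists v, y = m v]) _)).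
    move=> x; apply: contrapT => H; apply: nx; exists x => v.
    by apply: contrapT => vx; apply: H; exists (m v); split=> //; exists v.
  apply: (@embeds_cover _ _ (fun u v => sval u = m v)).
    by move=> [y [v yv]]; exists v.
  by move=> u v w uw vw; apply: sval_inj; rewrite uw vw.
apply/smallE; have sx : smallT M {y | ~ ltM x y} by apply: smallT_under.
have sk : smallT M {j | ltK j k} by apply: smallT_le Ksmall; apply: embeds_sig.
apply: smallT_le (smallT_prod Minf sk sx).
have emb v : embeds {y | D v y} {y | ~ ltM x y}.
  apply: embeds_trans (mP v) _; apply: embeds_sub => y vy xy.
  exact/vy/(tr _ _ _ (mx v)).
have [g gI] : exists g : forall v, {y | D v y} -> {y | ~ ltM x y},
    forall v, injective (g v).
  by exists (fun v => sval (cid (emb v))) => v; apply: svalP (cid (emb v)).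
apply: (@embeds_cover _ _ (fun u p => exists v (Du : D v (sval u)),
  p = (v, g v (exist _ _ Du)))).
  by move=> [y [v Dy]]; eexists; exists v, Dy.
move=> u u' p [v [Du ->]] [v' [Du' [e]]]; subst v'.
by move=> /gI [] /sval_inj.
Qed.

(** Recursion along [K] builds an increasing chain of conditions: stage [k] glues the earlier ones,
    which stays small by [small_union_below], and extends the result to miss [N k]. The union of the
    chain lies in no [N k]. *)
Theorem baire_category (R : Type) (r0 : R) :
  ~ kappa_meagre K [set: M -> R].
Proof.
move=> [N [Nnd cover]].
pose cond := (set M * (M -> R))%type.
have [ext extP] : exists ext : K * cond -> cond, forall kp, small kp.2.1 ->
    [/\ small (ext kp).1, kp.2.1 `<=` (ext kp).1,
      forall x, kp.2.1 x -> (ext kp).2 x = kp.2.2 x &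
      forall f, cyl (ext kp).1 (ext kp).2 f -> ~ N kp.1 f].
  suff /fun_choice : forall kp : K * cond, exists p : cond, small kp.2.1 ->
    [/\ small p.1, kp.2.1 `<=` p.1, forall x, kp.2.1 x -> p.2 x = kp.2.2 x &
      forall f, cyl p.1 p.2 f -> ~ N kp.1 f] by [].
  (* A condition with large support is returned unchanged, only to make [ext] total. *)
  move=> [k [D s]] /=; have [sD|nD] := pselect (small D); last by exists (D, s).
  have [D' [s' H]] := (nwdP Minf _).1 (Nnd k) D s sD.
  by exists (D', s').
pose dom I (p : I -> cond) : set M := [set x | exists i, (p i).1 x].
(* An arbitrary condition defined at [x] supplies the value; coherence of the chain makes the choice
   irrelevant. *)
pose glue I (p : I -> cond) x :=
  if pselect (exists i, (p i).1 x) is left H then (p (sval (cid H))).2 x else r0.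
have glueP I (p : I -> cond) x : dom I p x ->
    exists2 i, (p i).1 x & glue I p x = (p i).2 x.
  rewrite /glue => dx; case: pselect => [H|//].
  by exists (sval (cid H)) => //; apply: svalP (cid H).
have [g gE] := wf_rec
  (fun k (r : {j | ltK j k} -> cond) => ext (k, (dom _ r, glue _ r))) Kwo.2.2.2.
pose good k := [/\ small (g k).1,
  forall j, ltK j k -> (g j).1 `<=` (g k).1,
  forall j, ltK j k -> forall x, (g j).1 x -> (g k).2 x = (g j).2 x &
  forall f, cyl (g k).1 (g k).2 f -> ~ N k f].
have [irr [_ [tri wf]]] := Kwo.
have gP k : good k.
  elim/(well_founded_induction wf): k => k IH.
  pose r (v : {j | ltK j k}) := g (sval v).
  have [|e1 e2 e3 e4] := extP (k, (dom _ r, glue _ r)).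
    by apply: small_union_below => v; have [] := IH _ (svalP v).
  have gk : g k = ext (k, (dom _ r, glue _ r)) by rewrite gE.
  have below j (jk : ltK j k) x : (g j).1 x -> dom _ r x.
    by move=> jx; exists (exist (fun j => ltK j k) j jk).
  rewrite /good gk; split=> //.
  - by move=> j jk x jx; apply/e2/(below j).
  - move=> j jk x jx; have dx := below j jk x jx.
    rewrite e3 //=; have [[i ik] /= ix ->] := glueP _ r x dx; rewrite /r /=.
    have [_ _ ci _] := IH i ik; have [_ _ cj _] := IH j jk.
    by have [->|[ij|ji]] := tri i j; [|rewrite (cj i ij)|rewrite (ci j ji)].
have coh j k x : (g j).1 x -> (g k).1 x -> (g j).2 x = (g k).2 x.
  have [_ _ cj _] := gP j; have [_ _ ck _] := gP k.
  by have [->|[jk|kj]] := tri j k => // jx kx; [rewrite (ck j jk)|rewrite (cj k kj)].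
have [k _] := cover (glue _ g) I.
have [_ _ _ gN] := gP k; apply: gN => x kx.
by have [j jx ->] := glueP _ g x (ex_intro _ k kx); apply: coh.
Qed.

End Baire.

(** * Transfer of nonmeagre sets between values in 2 and values in mu *)

Section Transfer.
Context (M : Type) (Minf : embeds nat M).

Lemma nonmeagre_bool_of_fun K (B : set (M -> M)) : ~ kappa_meagre K B ->
  exists A : set (M -> bool), ~ kappa_meagre K A /\ A #<= B.
Proof.
move=> nB; have [e eI] := Minf.
pose p (m : M) := `[< m = e 0 >]; pose r (b : bool) := if b then e 0 else e 1.
have rK : cancel r p.
  by case; rewrite /p /r; [rewrite asboolT|rewrite asboolF // => /eI].
exists ((fun f => p \o f) @` B); split; last exact: card_image_le.
apply: nonmeagre_image nB => N Nnd; apply: (nwd_override Minf) => D s sD.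
have [D' [s' [sD' DD' s's s'N]]] := (nwdP Minf N).1 Nnd D (p \o s) sD.
(* The section [r] lifts the new bits to [M]; on [D] the values of [s] remain and already project to
   [s']. *)
exists D', (r \o s'); split=> // f fs fs'; apply: s'N => x D'x /=.
have [Dx|nDx] := pselect (D x); first by rewrite fs // s's.
by rewrite fs' // overrideF //= rK.
Qed.

(* A pattern of [L] bits codes an element of [M]. *)
Lemma nonmeagre_fun_of_bool K L (A : set (M -> bool)) : smallT M L ->
  embeds M (L -> bool) -> ~ kappa_meagre K A ->
  exists B : set (M -> M), ~ kappa_meagre K B /\ B #<= A.
Proof.
move=> sL [i iI] nA; have [i' iP] := partial_inverse iI.
have [e0 _] := Minf; pose m0 := e0 0.
pose d p := if i' p is Some m then m else m0.
have dK m : d (i m) = m by rewrite /d (iP _ m).2.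
have [e eI] : embeds (M * L) M.
  apply: embeds_trans (embeds_square Minf).
  exact: embeds_prod (embeds_refl _) (smallT_embeds sL).
have [q qP] := partial_inverse eI.
pose phi (g : M -> bool) a := d (fun l => g (e (a, l))).
exists (phi @` A); split; last exact: card_image_le.
apply: nonmeagre_image nA => N Nnd; apply/(nwdP Minf) => D s sD.
(* The rows touched by [D] may be only partly fixed; all of them are frozen as in [s], so they
   decode to [phi s]. *)
pose E : set M := [set a | exists l, D (e (a, l))].
have sE : small E.
  apply/smallE; move/smallE: sD; apply: smallT_le.
  apply: (@embeds_cover _ _ (fun a z => exists l, sval z = e (sval a, l))).
    by move=> [a [l Dl]]; exists (exist D _ Dl), l.
  by move=> a a' z [l ->] [l' /eI [/sval_inj]].
have [E' [t [sE' EE' tE tN]]] := (nwdP Minf N).1 Nnd E (phi s) sE.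
(* Untouched rows are free, so they can carry the code of the value [t a]. *)
pose s' z := if q z is Some (a, l) then
  if pselect (E a) then s z else i (t a) l else s z.
have s'e a l : s' (e (a, l)) = if pselect (E a) then s (e (a, l)) else i (t a) l.
  by rewrite /s' (qP _ (a, l)).2.
exists (D `|` [set z | exists p : {a | E' a} * L, z = e (sval p.1, p.2)]), s'.
split.
- apply: small_setU => //; apply: small_image; apply: smallT_prod => //.
  exact/smallE.
- by left.
- move=> z Dz; rewrite /s'; case qz: (q z) => [[a l]|//].
  case: pselect => // nE; case: nE; exists l.
  by have -> := (qP z (a, l)).1 qz.
- move=> g gs'; apply: tN => a E'a.
  have row l : g (e (a, l)) = s' (e (a, l)).
    by apply: gs'; right; exists (exist E' a E'a, l).
  rewrite /phi; have [Ea|nEa] := pselect (E a).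
    rewrite tE // /phi; congr d; apply/funext => l; rewrite row s'e.
    by case: pselect.
  rewrite -[RHS]dK; congr d; apply/funext => l; rewrite row s'e.
  by case: pselect.
Qed.

End Transfer.

Theorem mainTheorem12 (K : Type) (ltK : K -> K -> Prop)
    (M : Type) (ltM : M -> M -> Prop) :
  regular_infinite ltK ->
  initial_ordinal ltM ->
  singular K ltM ->
  (* mu^{<mu} <= non(M_kappa(^mu 2, mu)) *)
  (forall A : set (M -> bool), ~ kappa_meagre K A ->
     [set: lt_mu_functions ltM] #<= A) /\
  (* non(M_kappa(^mu 2, mu)) = non(M_kappa(^mu mu, mu)) *)
  (forall A : set (M -> bool), ~ kappa_meagre K A ->
     exists B : set (M -> M), ~ kappa_meagre K B /\ B #<= A) /\
  (forall B : set (M -> M), ~ kappa_meagre K B ->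
     exists A : set (M -> bool), ~ kappa_meagre K A /\ A #<= B).
Proof.
move=> [[Kwo Kinit0] [/infiniteP/card_leTTE Kinf _]] [Mwo Minit0].
move=> [[[C [Ccof CK]] Kcf0] MK0].
have Ksmall : smallT M K by rewrite /smallT -card_leTTE.
have Minf : embeds nat M by apply: embeds_trans Kinf (smallT_embeds Ksmall).
have Minit x : smallT M {y | ltM y x} by move=> /card_leTE /Minit0.
have Kinit k : ~ embeds K {j | ltK j k} by move=> /card_leTE /Kinit0.
have Kcf (D : set M) : cofinal ltM D -> embeds K {x | D x}.
  by move=> /Kcf0 /card_leTE.
have [k0 _] := Kinf; have {}k0 := k0 0.
have [c c_cofinal] : exists c : K -> M, forall x, exists k, ~ ltM (c k) x.
  move: CK => /card_eqPle [/card_leE CK _].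
  have [i iI] := embeds_trans CK (embeds_sig _); have [q qP] := partial_inverse iI.
  have [e _] := Minf.
  (* An injection of the cofinal set into [K] is inverted, with [e 0] as default off its range. *)
  exists (fun k => if q k is Some u then sval u else e 0) => x.
  have [y [Cy yx]] := Ccof x; exists (i (exist C y Cy)).
  by rewrite (qP _ (exist C y Cy)).2.
split; last split.
- move=> A nA; apply/card_leTE.
  exact: (nonmeagre_lt_mu (c := c)) nA.
- move=> A nA.
  (* Either mu <= 2^lambda for the size lambda of some segment, or every segment has a power set
     smaller than [M]. *)
  have [[k Mk]|nk] := pselect (exists k, embeds M ({y | ~ ltM (c k) y} -> bool)).
    by apply: (nonmeagre_fun_of_bool Minf _ Mk nA); apply: smallT_under.
  have [e _] := Minf; exists setT; split.
    exact: (baire_category Minf Mwo Minit Ksmall c_cofinal Kwo Kinit Kcf (e 0)).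
  apply/card_leTE.
  apply: embeds_trans (nonmeagre_fun Minf Mwo Minit Ksmall c_cofinal k0 nA Ksmall).
  have graph : embeds (M -> M) (M * M -> bool).
    exists (fun f p => `[< f p.1 = p.2 >]) => f g fg; apply/funext => x.
    have /(congr1 (@^~ (x, f x))) := fg.
    by rewrite /= asboolT // => /esym /asboolP.
  apply: embeds_trans graph _.
  apply: embeds_trans (embeds_fun (embeds_square Minf) true) _.
  (* A subset of [M] is determined by its traces on the segments up to [c k], and each trace is
     coded by one element of [M]; this gives 2^mu <= mu^kappa. *)
  have [i iI] : exists i : forall k, ({y | ~ ltM (c k) y} -> bool) -> M,
      forall k, injective (i k).
    have H k : embeds ({y | ~ ltM (c k) y} -> bool) M.
      by apply: smallT_embeds => Mk; apply: nk; exists k.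
    by exists (fun k => sval (cid (H k))) => k; apply: svalP (cid (H k)).
  exists (fun p k => i k (fun y => p (sval y))) => p p' pp'; apply/funext => x.
  have [k kx] := c_cofinal x.
  have /iI /(congr1 (@^~ (exist _ x kx))) := congr1 (@^~ k) pp'.
  exact.
- exact: nonmeagre_bool_of_fun.
Qed.
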